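(* Let $M$ be a $d\times d$ dilation matrix and let $t$ be a trigonometric polynomial in $d$ variables. If $t\in\mathcal{Z}^0$, then there exist trigonometric polynomials $t_{jk}$, $j,k=1,\dots,d$, such that for every $k=1,\dots,d$ $$(1-e^{2\pi i(x,\mathbf{e}_k)})\,t(x)=\sum_{j=1}^d t_{jk}(x)\,(1-e^{2\pi i(M^*x,\mathbf{e}_j)}).\qquad(\ast)$$ Conversely, if $t$ is a trigonometric polynomial and $(\ast)$ holds for every $k=1,\dots,d$ with some trigonometric polynomials $t_{jk}$, $j,k=1,\dots,d$, then $t\in\mathcal{Z}^0$ and $t_{jk}(\mathbf{0})=(M^{-1})_{jk}\,t(\mathbf{0})$ for all $j,k=1,\dots,d$.
   Context: A dilation matrix $M$ is a non-degenerate $d\times d$ integer matrix all of whose eigenvalues are larger than $1$ in modulus; $M^*$ is its transpose. $\mathbf{e}_j$ is the $j$-th unit vector of $\mathbb{R}^d$, $(\cdot,\cdot)$ is the standard inner product, $\mathbf{0}$ is the zero vector. A trigonometric polynomial is a function $t(x)=\sum_{n\in\mathbb{Z}^d}\widehat t(n)e^{2\pi i(n,x)}$, $x\in\mathbb{R}^d$, with only finitely many non-zero coefficients. $D(M^* )$ is a set of representatives (digits) of the cosets $\mathbb{Z}^d/M^*\mathbb{Z}^d$, containing $\mathbf{0}$. $\mathcal{Z}^0$ is the set of trigonometric polynomials $t$ such that $t({M^*}^{-1}s)=0$ for all $s\in D(M^* )$, $s\ne\mathbf{0}$. *)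

(* Defs.v *)
From HB Require Import structures.
From mathcomp Require Import all_boot all_order all_algebra.
From mathcomp Require Import all_classical all_reals all_analysis.
From mathcomp Require Import complex.

Set Implicit Arguments.
Unset Strict Implicit.
Unset Printing Implicit Defensive.

Import Order.TTheory GRing.Theory Num.Theory.
Local Open Scope classical_set_scope.
Local Open Scope ring_scope.
Local Open Scope complex_scope.

Definition dilation_matrix (R : realType) (d : nat) (M : 'M[int]_d) : Prop :=
  \det M != 0 /\
  forall a : R[i], eigenvalue (map_mx intr M) a -> 1 < `|a|.

Definition inner (R : realType) (d : nat) (x y : 'cV[R]_d) : R :=
  \sum_(i < d) x i 0 * y i 0.

Definition unit_vec (R : realType) (d : nat) (j : 'I_d) : 'cV[R]_d :=
  delta_mx j 0.

Definition expi2pi (R : realType) (u : R) : R[i] :=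
  cos (2 * pi * u) +i* sin (2 * pi * u).

(* The sum over all of Z^d is the finitely supported [fsbigop] sum (equal to 0
   on infinite support, whence the finiteness clause). *)
Definition trig_poly (R : realType) (d : nat) (t : 'cV[R]_d -> R[i]) : Prop :=
  exists c : 'cV[int]_d -> R[i],
    finite_set [set n | c n != 0] /\
    forall x, t x = \sum_(n \in [set: 'cV[int]_d])
                      c n * expi2pi (inner (map_mx intr n) x).

Definition digit_set (d : nat) (A : 'M[int]_d) (D : set 'cV[int]_d) : Prop :=
  D 0 /\
  forall n : 'cV[int]_d,
    exists! s, D s /\ exists m : 'cV[int]_d, n = s + A *m m.

(* [D] is meant to be a digit set of the transpose [M^T], not of [M]. *)
Definition Z0 (R : realType) (d : nat) (M : 'M[int]_d) (D : set 'cV[int]_d)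
    (t : 'cV[R]_d -> R[i]) : Prop :=
  trig_poly t /\
  forall s, D s -> s != 0 -> t (invmx (map_mx intr M^T) *m map_mx intr s) = 0.

(* Main.v *)
Require Import Defs.
From HB Require Import structures.
From mathcomp Require Import all_boot all_order all_algebra.
From mathcomp Require Import all_classical all_reals all_analysis.
From mathcomp Require Import complex.
From mathcomp Require Import ring lra.

Set Implicit Arguments.
Unset Strict Implicit.
Unset Printing Implicit Defensive.

Import Order.TTheory GRing.Theory Num.Theory.
Local Open Scope classical_set_scope.
Local Open Scope ring_scope.
Local Open Scope complex_scope.

(** Write e(n) for the exponential monomial x |-> e^(2 pi i (n,x)), n an integer
    vector, and I for the ideal of trigonometric polynomials generated by the
    1 - e(M e_j); equation number k of the theorem says that
    F_k = (1 - e(e_k)) t lies in I, because (M^T x, e_j) = (x, M e_j).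

    Direct part.  An integer vector is a digit r plus a vector of M^T Z^d, so by
    periodicity the values of F_k on the whole of M^-T Z^d are those at the
    points M^-T r.  They vanish: by hypothesis on t if r <> 0, and because of
    the factor 1 - e(e_k) if r = 0.  The points of M^-T Z^d give the characters
    of the finite group Z^d / M Z^d, so by orthogonality of characters
    [coset_sum_eq0] the coefficients of F_k add up to 0 over every coset of
    M Z^d.  Choosing a representative rho(n) in each coset, F_k = sum c_n e(n)
    can be rewritten as sum c_n (e(n) - e(rho(n))), and each difference is a
    monomial times some 1 - e(M m), which is in I [in_ideal_lattice]: the m for
    which 1 - e(M m) is in I form a group containing the unit vectors.

    Orthogonality is proved by summing over the box of the s with coordinates
    in {0, ..., N-1}, N = |det M|, in place of a system of digits.  The value of
    e(n) at M^-T s is the product of the w_i^(s_i), where w_i is e^(2 pi i y)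
    for y the i-th coordinate of M^-1 n; since w_i^N = 1, the sum factors into
    geometric sums, one of which vanishes unless M^-1 n is an integer vector.

    Converse part.  At x = M^-T s the right-hand sides vanish, so t(x) <> 0
    forces every coordinate of x to be an integer; then s lies in M^T Z^d, the
    coset of the digit 0, and s = 0.  For the values at 0, restrict equation k to
    the line x = h M^-T e_j: only the j-th term survives on the right, and the
    equation becomes (1 - e^(2 pi i a h)) t = (1 - e^(2 pi i h)) t_jk with
    a = (M^-1)_jk.  Comparing derivatives at h = 0 gives a t(0) = t_jk(0). *)

(** * The exponential e^(2 pi i u) *)

Lemma expi2pi0 (R : realType) : expi2pi (0 : R) = 1.
Proof. by rewrite /expi2pi mulr0 cos0 sin0. Qed.

Lemma expi2piD (R : realType) (u v : R) :
  expi2pi (u + v) = expi2pi u * expi2pi v.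
Proof.
rewrite /expi2pi mulrDr cosD sinD; simpc.
by congr (_ +i* _); rewrite addrC.
Qed.

Lemma expi2pi_neq0 (R : realType) (u : R) : expi2pi u != 0.
Proof.
apply/eqP => e0; have := expi2piD u (- u).
by rewrite subrr expi2pi0 e0 mul0r => /eqP; rewrite oner_eq0.
Qed.

Lemma expi2piN (R : realType) (u : R) : expi2pi (- u) = (expi2pi u)^-1.
Proof.
apply: (mulfI (expi2pi_neq0 u)).
by rewrite -expi2piD subrr expi2pi0 divff ?expi2pi_neq0.
Qed.

Lemma expi2piMn (R : realType) (u : R) n : expi2pi (u *+ n) = expi2pi u ^+ n.
Proof.
elim: n => [|n IH]; first by rewrite mulr0n expi2pi0.
by rewrite mulrS expi2piD IH exprS.
Qed.

Lemma expi2pi_int (R : realType) (m : int) : expi2pi (m%:~R : R) = 1.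
Proof.
have e1 : expi2pi (1 : R) = 1.
  by rewrite /expi2pi mulr1 mulr_natl cos2pi sin2pi.
case: m => n; last rewrite NegzE mulrNz expi2piN.
  by rewrite -pmulrn expi2piMn e1 expr1n.
by rewrite -pmulrn expi2piMn e1 expr1n invr1.
Qed.

Lemma expi2pi_sum (R : realType) (I : Type) (s : seq I) (F : I -> R) :
  expi2pi (\sum_(i <- s) F i) = \prod_(i <- s) expi2pi (F i).
Proof.
by apply: (big_morph _ (@expi2piD R)); exact: expi2pi0.
Qed.

Lemma expi2pi_eq1 (R : realType) (u : R) :
  expi2pi u = 1 -> exists m : int, u = m%:~R.
Proof.
move=> eu1; exists (Num.floor u).
set w := u - (Num.floor u)%:~R.
have w0 : 0 <= w by rewrite subr_ge0 floor_le_tmp.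
have w1 : w < 1.
  by rewrite ltrBlDl -[X in _ + X]/(1%:~R) -intrD floorD1_gt.
have ew1 : expi2pi w = 1.
  by rewrite expi2piD expi2piN expi2pi_int eu1 invr1 mulr1.
apply/eqP; rewrite -subr_eq0 -/w eq_le w0 andbT leNgt; apply/negP => wpos.
(* The double angle formula turns cos (2 pi w) = 1 into sin (pi w) = 0, whereas
   pi w lies strictly between 0 and pi. *)
have sgt : 0 < sin (pi * w).
  by apply: sin_gt0_pi; rewrite mulr_gt0 ?pi_gt0//= gtr_pMr ?pi_gt0.
have : cos (2 * pi * w) = 1 by case: ew1.
rewrite (_ : 2 * pi * w = (pi * w) *+ 2); last by rewrite -mulrA mulr_natl.
rewrite cos_mulr2n => h.
have := cos2Dsin2 (pi * w) => h2.
have : sin (pi * w) ^+ 2 *+ 2 = 0 by lra.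
by move=> /eqP; rewrite mulrn_eq0 /= sqrf_eq0 gt_eqF.
Qed.

(** * The inner product *)

Lemma innerE (R : realType) d (x y : 'cV[R]_d) : inner x y = (x^T *m y) 0 0.
Proof. by rewrite /inner mxE; apply: eq_bigr => i _; rewrite mxE. Qed.

Lemma innerDl (R : realType) d (x x' y : 'cV[R]_d) :
  inner (x + x') y = inner x y + inner x' y.
Proof. by rewrite !innerE linearD mulmxDl mxE. Qed.

Lemma innerNl (R : realType) d (x y : 'cV[R]_d) : inner (- x) y = - inner x y.
Proof. by rewrite !innerE linearN mulNmx mxE. Qed.

Lemma inner0l (R : realType) d (y : 'cV[R]_d) : inner 0 y = 0.
Proof. by rewrite innerE trmx0 mul0mx mxE. Qed.

Lemma inner_mulmx (R : realType) d (A : 'M[R]_d) (x y : 'cV[R]_d) :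
  inner x (A *m y) = inner (A^T *m x) y.
Proof. by rewrite !innerE trmx_mul trmxK mulmxA. Qed.

Lemma innerC (R : realType) d (x y : 'cV[R]_d) : inner x y = inner y x.
Proof. by apply: eq_bigr => i _; rewrite mulrC. Qed.

Lemma innerZr (R : realType) d (a : R) (x y : 'cV[R]_d) :
  inner x (a *: y) = a * inner x y.
Proof. by rewrite !innerE -scalemxAr mxE. Qed.

Lemma inner_unit_vec (R : realType) d (x : 'cV[R]_d) k :
  inner x (unit_vec R k) = x k 0.
Proof.
rewrite innerC /inner (bigD1 k) //= big1 => [|i ik]; rewrite !mxE !eqxx.
  by rewrite mul1r addr0.
by rewrite (negbTE ik) mul0r.
Qed.

(** * The exponential monomials *)

Definition wave (R : realType) d (n : 'cV[int]_d) (x : 'cV[R]_d) : R[i] :=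
  expi2pi (inner (map_mx intr n) x).

Lemma wave0 (R : realType) d (x : 'cV[R]_d) : wave 0 x = 1.
Proof. by rewrite /wave map_mx0 inner0l expi2pi0. Qed.

Lemma waveD (R : realType) d (m n : 'cV[int]_d) (x : 'cV[R]_d) :
  wave (m + n) x = wave m x * wave n x.
Proof. by rewrite /wave map_mxD innerDl expi2piD. Qed.

Lemma waveN (R : realType) d (n : 'cV[int]_d) (x : 'cV[R]_d) :
  wave (- n) x = (wave n x)^-1.
Proof. by rewrite /wave map_mxN innerNl expi2piN. Qed.

Lemma map_intr_cV_inj (R : realType) d :
  injective (fun n : 'cV[int]_d => map_mx intr n : 'cV[R]_d).
Proof.
move=> m n /matrixP mn; apply/matrixP => j k; apply: (@intr_inj R).
by have := mn j k; rewrite !mxE.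
Qed.

Lemma wave_int (R : realType) d (n m : 'cV[int]_d) :
  wave n (map_mx intr m : 'cV[R]_d) = 1.
Proof.
rewrite /wave innerE map_trmx -map_mxM mxE; exact: expi2pi_int.
Qed.

Lemma waveDr (R : realType) d (n : 'cV[int]_d) (x y : 'cV[R]_d) :
  wave n (x + y) = wave n x * wave n y.
Proof. by rewrite /wave innerC innerDl expi2piD !(innerC _ (map_mx _ _)). Qed.

Lemma wave_unit_vec (R : realType) d (k : 'I_d) (x : 'cV[R]_d) :
  wave (delta_mx k 0) x = expi2pi (inner x (unit_vec R k)).
Proof. by rewrite /wave map_delta_mx innerC. Qed.

Lemma wave_col (R : realType) d (M : 'M[int]_d) (j : 'I_d) (x : 'cV[R]_d) :
  wave (M *m delta_mx j 0) x =
  expi2pi (inner (map_mx intr M^T *m x) (unit_vec R j)).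
Proof.
rewrite /wave map_mxM map_delta_mx [in RHS]innerC inner_mulmx.
by rewrite map_trmx trmxK.
Qed.

Lemma wave_neq0 (R : realType) d (n : 'cV[int]_d) (x : 'cV[R]_d) :
  wave n x != 0.
Proof. exact: expi2pi_neq0. Qed.

Lemma wave_at0 (R : realType) d (n : 'cV[int]_d) : wave n (0 : 'cV[R]_d) = 1.
Proof. by rewrite /wave innerC inner0l expi2pi0. Qed.

(** * Trigonometric polynomials as finite lists of terms *)

(** Frequencies may be repeated in the list: sums and products with a monomial
    are then concatenation and mapping, without any merging of terms. *)
Definition epoly (R : realType) d (l : seq (R[i] * 'cV[int]_d)) (x : 'cV[R]_d) :=
  \sum_(p <- l) p.1 * wave p.2 x.

Lemma trig_polyP (R : realType) d (t : 'cV[R]_d -> R[i]) :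
  trig_poly t <-> exists l, t =1 epoly l.
Proof.
split=> [[c [cfin tE]]|[l tE]].
  exists [seq (c n, n) | n <- finmap.enum_fset (fset_set [set n | c n != 0])].
  move=> x; rewrite tE /epoly big_map -fsbig_finite //.
  apply/esym/fsbig_widen => // n [_ /=] /negP; rewrite negbK => /eqP ->.
  by rewrite mul0r.
(* Merge the terms with the same frequency. *)
pose c n := \sum_(p <- l | p.2 == n) p.1.
have c0 n : n \notin map snd l -> c n = 0.
  move=> nl; rewrite /c big_seq_cond big1 // => p /andP[pl /eqP pn].
  by move: nl; rewrite -pn map_f.
exists c; split.
  apply: (@sub_finite_set _ _ [set` map snd l]); last exact: finite_seq.
  by move=> n /=; apply: contraNT => /c0 ->.
move=> x; rewrite tE.
rewrite (fsbigE (undup (map snd l))) ?undup_uniq //; last first.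
  by move=> n _; rewrite mem_undup => /c0 ->; rewrite mul0r.
rewrite big_mkcond /=.
under eq_bigr => n _ do rewrite in_setT /c big_distrl big_mkcond /=.
rewrite exchange_big /= /epoly !big_seq; apply: eq_bigr => p pl.
rewrite (bigD1_seq p.2) ?undup_uniq ?mem_undup ?map_f //= eqxx big1 ?addr0 //.
by move=> n; rewrite eq_sym => /negbTE ->.
Qed.

Lemma eq_trig_poly (R : realType) d (t u : 'cV[R]_d -> R[i]) :
  t =1 u -> trig_poly t -> trig_poly u.
Proof. by move=> /funext ->. Qed.

Lemma trig_polyD (R : realType) d (t u : 'cV[R]_d -> R[i]) :
  trig_poly t -> trig_poly u -> trig_poly (fun x => t x + u x).
Proof.
move=> /trig_polyP[l tE] /trig_polyP[m uE].
by apply/trig_polyP; exists (l ++ m) => x; rewrite /epoly big_cat tE uE.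
Qed.

Lemma trig_poly0 (R : realType) d : trig_poly (fun _ : 'cV[R]_d => 0).
Proof. by apply/trig_polyP; exists [::] => x; rewrite /epoly big_nil. Qed.

Lemma trig_poly_monoM (R : realType) d c n (t : 'cV[R]_d -> R[i]) :
  trig_poly t -> trig_poly (fun x => c * wave n x * t x).
Proof.
move=> /trig_polyP[l tE].
apply/trig_polyP; exists [seq (c * p.1, n + p.2) | p <- l] => x.
rewrite /epoly big_map tE big_distrr; apply: eq_bigr => p _ /=.
by rewrite waveD mulrACA.
Qed.

Lemma trig_poly_mono (R : realType) d c n :
  trig_poly (fun x : 'cV[R]_d => c * wave n x).
Proof.
by apply/trig_polyP; exists [:: (c, n)] => x; rewrite /epoly big_seq1.
Qed.

Lemma trig_poly_periodic (R : realType) d (t : 'cV[R]_d -> R[i]) x m :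
  trig_poly t -> t (x + map_mx intr m) = t x.
Proof.
move=> /trig_polyP[l tE]; rewrite !tE; apply: eq_bigr => p _.
by rewrite waveDr wave_int mulr1.
Qed.

(** * The ideal generated by the 1 - e(M e_j) *)

Definition in_ideal (R : realType) d (M : 'M[int]_d) (f : 'cV[R]_d -> R[i]) :=
  exists q : 'I_d -> 'cV[R]_d -> R[i], (forall j, trig_poly (q j)) /\
    forall x, f x = \sum_(j < d) q j x * (1 - wave (M *m delta_mx j 0) x).

Lemma eq_in_ideal (R : realType) d (M : 'M[int]_d) (f g : 'cV[R]_d -> R[i]) :
  f =1 g -> in_ideal M f -> in_ideal M g.
Proof. by move=> /funext ->. Qed.

Lemma in_ideal0 (R : realType) d (M : 'M[int]_d) :
  in_ideal M (fun _ : 'cV[R]_d => 0).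
Proof.
exists (fun _ _ => 0); split=> [j|x]; first exact: trig_poly0.
by rewrite big1 // => j _; rewrite mul0r.
Qed.

Lemma in_idealD (R : realType) d (M : 'M[int]_d) (f g : 'cV[R]_d -> R[i]) :
  in_ideal M f -> in_ideal M g -> in_ideal M (fun x => f x + g x).
Proof.
move=> [q [qt fE]] [r [rt gE]].
exists (fun j x => q j x + r j x); split=> [j|x]; first exact: trig_polyD.
by rewrite fE gE -big_split; apply: eq_bigr => j _; rewrite mulrDl.
Qed.

Lemma in_ideal_monoM (R : realType) d (M : 'M[int]_d) c n
    (f : 'cV[R]_d -> R[i]) :
  in_ideal M f -> in_ideal M (fun x => c * wave n x * f x).
Proof.
move=> [q [qt fE]].
exists (fun j x => c * wave n x * q j x); split=> [j|x].
  exact: trig_poly_monoM.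
by rewrite fE big_distrr; apply: eq_bigr => j _; rewrite /= mulrA.
Qed.

Lemma in_ideal_sum (R : realType) d (M : 'M[int]_d) (I : Type) (s : seq I)
    (F : I -> 'cV[R]_d -> R[i]) :
  (forall i, in_ideal M (F i)) -> in_ideal M (fun x => \sum_(i <- s) F i x).
Proof.
move=> FM; elim: s => [|i s IH].
  by apply: eq_in_ideal (in_ideal0 _ M) => x; rewrite big_nil.
by apply: eq_in_ideal (in_idealD (FM i) IH) => x; rewrite big_cons.
Qed.

(** The frequencies n with 1 - e(n) in the ideal form a group, by
    1 - e(a + b) = (1 - e(a)) + e(a) (1 - e(b)) and
    1 - e(-a) = - e(-a) (1 - e(a)), and this group contains the columns of M. *)
Lemma in_ideal_lattice (R : realType) d (M : 'M[int]_d) (m : 'cV[int]_d) :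
  in_ideal M (fun x : 'cV[R]_d => 1 - wave (M *m m) x).
Proof.
pose P (n : 'cV[int]_d) := in_ideal M (fun x : 'cV[R]_d => 1 - wave n x).
have P0 : P 0.
  by apply: eq_in_ideal (in_ideal0 _ M) => x; rewrite wave0 subrr.
have PD a b : P a -> P b -> P (a + b).
  move=> Pa Pb; apply: eq_in_ideal (in_idealD Pa (in_ideal_monoM 1 a Pb)) => x.
  by rewrite waveD; ring.
have PN a : P a -> P (- a).
  move=> Pa; apply: eq_in_ideal (in_ideal_monoM (-1) (- a) Pa) => x.
  by rewrite waveN; field; exact: wave_neq0.
have PMn a k : P a -> P (a *+ k).
  by move=> Pa; elim: k => [//|k IH]; rewrite mulrS; exact: PD.
have Pgen j : P (M *m delta_mx j 0).
  exists (fun i x => (i == j)%:R * wave 0 x); split=> [i|x].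
    exact: trig_poly_mono.
  rewrite (bigD1 j) //= eqxx wave0 !mul1r big1 ?addr0 // => i /negbTE ->.
  by rewrite !mul0r.
rewrite -/(P _) (_ : M *m m = \sum_j (M *m delta_mx j 0) *~ m j 0); last first.
  rewrite {1}[m]matrix_sum_delta mulmx_sumr; apply: eq_bigr => j _.
  by rewrite big_ord1 -scalemxAr -scaler_int intz.
elim/big_ind: _ => // j _; case: (m j 0) => k.
  by rewrite -pmulrn; exact: PMn.
by rewrite NegzE mulrNz -pmulrn; apply/PN/PMn.
Qed.

(** * Cosets of the lattice M Z^d *)

Definition in_lattice d (M : 'M[int]_d) : pred 'cV[int]_d :=
  fun n => `[< exists m, n = M *m m >].

Lemma in_lattice0 d (M : 'M[int]_d) : in_lattice M 0.
Proof. by apply/asboolP; exists 0; rewrite mulmx0. Qed.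

Lemma in_latticeB d (M : 'M[int]_d) a b :
  in_lattice M a -> in_lattice M b -> in_lattice M (a - b).
Proof.
move=> /asboolP[m ->] /asboolP[n ->]; apply/asboolP; exists (m - n).
by rewrite mulmxBr.
Qed.

Lemma in_lattice_congr d (M : 'M[int]_d) a b c :
  in_lattice M (a - b) -> in_lattice M (a - c) = in_lattice M (b - c).
Proof.
move=> ab; apply/idP/idP => [ac|bc].
  by have := in_latticeB ac ab; rewrite opprB addrC subrKA.
have ba : in_lattice M (b - a).
  by rewrite -[_ - _]opprB -sub0r; apply: in_latticeB ab; exact: in_lattice0.
by have := in_latticeB bc ba; rewrite opprB addrC subrKA.
Qed.

(** The canonical choice depends only on the extension of the predicate, here
    the coset of n, and not on the starting point n. *)
Definition lattice_repr d (M : 'M[int]_d) n :=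
  choose (fun r => in_lattice M (n - r)) n.

Lemma lattice_reprP d (M : 'M[int]_d) n : in_lattice M (n - lattice_repr M n).
Proof.
apply: (@chooseP _ (fun r => in_lattice M (n - r)) n).
by rewrite subrr in_lattice0.
Qed.

Lemma lattice_reprE d (M : 'M[int]_d) a b :
  (lattice_repr M a == lattice_repr M b) = in_lattice M (a - lattice_repr M b).
Proof.
apply/eqP/idP => [<-|ab]; first exact: lattice_reprP.
have ab' : in_lattice M (a - b).
  rewrite (in_lattice_congr _ ab) -(in_lattice_congr _ (lattice_reprP M b)).
  by rewrite subrr in_lattice0.
rewrite /lattice_repr (@eq_choose _ _ (fun r => in_lattice M (b - r))); last first.
  by move=> r; exact: in_lattice_congr.
apply: choose_id; last by rewrite subrr in_lattice0.
by rewrite -(in_lattice_congr _ ab') subrr in_lattice0.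
Qed.

(** * Orthogonality of the characters of Z^d / M Z^d *)

(** The values of e(n) at the points M^-T s are the values of all the characters
    of Z^d / M Z^d at the class of n. *)
Definition dual_pt (R : realType) d (M : 'M[int]_d) (s : 'cV[int]_d) : 'cV[R]_d :=
  invmx (map_mx intr M^T) *m map_mx intr s.

Lemma unitmx_intr (R : realType) d (M : 'M[int]_d) :
  \det M != 0 -> map_mx intr M \in @unitmx R d.
Proof. by rewrite unitmxE det_map_mx unitfE intr_eq0. Qed.

Lemma wave_dual_pt (R : realType) d (M : 'M[int]_d) n s :
  wave n (dual_pt R M s) =
  \prod_(i < d) expi2pi
    ((invmx (map_mx intr M) *m map_mx intr n : 'cV[R]_d) i 0 * (s i 0)%:~R).
Proof.
rewrite /wave /dual_pt inner_mulmx trmx_inv map_trmx trmxK /inner expi2pi_sum.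
by apply: eq_bigr => i _; rewrite [map_mx _ s i 0]mxE.
Qed.

(** Cramer's rule: det M times M^-1 n is the integer vector adj(M) n. *)
Lemma expi2pi_invmx_exp_det (R : realType) d (M : 'M[int]_d) (n : 'cV[int]_d) i :
  \det M != 0 ->
  expi2pi ((invmx (map_mx intr M) *m map_mx intr n : 'cV[R]_d) i 0)
    ^+ `|\det M| = 1.
Proof.
move=> dM; rewrite -expi2piMn.
set y := _ *m _.
have yE : y i 0 * (\det M)%:~R = ((\adj M *m n) i 0)%:~R.
  rewrite /y /invmx unitmx_intr // det_map_mx -scalemxAl mxE mulrC mulrA.
  rewrite divff ?intr_eq0 // mul1r -map_mx_adj -map_mxM mxE.
  by [].
rewrite pmulrn -mulrzr.
have : ((`|\det M|%N : int) = \det M \/ (`|\det M|%N : int) = - \det M).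
  by rewrite abszE; case: (ger0P (\det M)); [left|right].
case=> ->; first by rewrite yE expi2pi_int.
by rewrite intrN mulrN yE expi2piN expi2pi_int invr1.
Qed.

Definition box_pt d N (f : {ffun 'I_d -> 'I_N}) : 'cV[int]_d :=
  \col_i (f i : nat)%:Z.

(** As |det M| Z^d is contained in M^T Z^d, the box covers each class of
    Z^d / M^T Z^d the same number of times; so this is orthogonality of
    characters up to a constant factor, with the advantage that the sum splits
    as a product of one geometric sum per coordinate. *)
Lemma wave_box_sum (R : realType) d (M : 'M[int]_d) (n : 'cV[int]_d) :
  \det M != 0 ->
  \sum_(f : {ffun 'I_d -> 'I_`|\det M|}) wave n (dual_pt R M (box_pt f)) =
  if in_lattice M n then #|{ffun 'I_d -> 'I_`|\det M|}|%:R else 0.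
Proof.
move=> dM; case: ifPn => [/asboolP[m ->]|nM].
  rewrite -sumr_const; apply: eq_bigr => f _.
  rewrite wave_dual_pt big1 // => i _.
  by rewrite map_mxM mulKmx ?unitmx_intr // mxE -intrM expi2pi_int.
pose y : 'cV[R]_d := invmx (map_mx intr M) *m map_mx intr n.
pose w (i : 'I_d) := expi2pi (y i 0).
have [i wi] : exists i, w i != 1.
  apply: contrapT => /forallNP w1; move/negP: nM; apply; apply/asboolP.
  have yint i : exists m : int, y i 0 = m%:~R.
    by apply: expi2pi_eq1; apply/eqP; have /negP := w1 i; rewrite negbK.
  have [m mE] := choice yint; exists (\col_i m i).
  apply: (@map_intr_cV_inj R); rewrite map_mxM.
  rewrite -[LHS](mulKVmx (unitmx_intr R dM)); congr (_ *m _).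
  by apply/matrixP => j k; rewrite ord1 -/y mE !mxE.
transitivity (\sum_(f : {ffun 'I_d -> 'I_`|\det M|}) \prod_i w i ^+ f i).
  apply: eq_bigr => f _; rewrite wave_dual_pt; apply: eq_bigr => j _.
  by rewrite [box_pt f j 0]mxE -expi2piMn -pmulrn mulr_natr.
rewrite -(bigA_distr_bigA (fun i (j : 'I_`|\det M|) => w i ^+ j)).
rewrite (bigD1 i) //=.
(* The i-th geometric sum is (w_i^N - 1) / (w_i - 1), and w_i^N = 1. *)
have /eqP := subrX1 (w i) `|\det M|.
rewrite expi2pi_invmx_exp_det // subrr eq_sym mulf_eq0 subr_eq0 (negbTE wi) /=.
by move=> /eqP ->; rewrite mul0r.
Qed.

(** Fourier inversion on Z^d / M Z^d: the sum over the coset of r is, up to a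
    nonzero factor, the average of e(-r) times the polynomial over the points
    M^-T s. *)
Lemma coset_sum_eq0 (R : realType) d (M : 'M[int]_d)
    (l : seq (R[i] * 'cV[int]_d)) :
  \det M != 0 -> (forall s, epoly l (dual_pt R M s) = 0) ->
  forall r, \sum_(p <- l | in_lattice M (p.2 - r)) p.1 = 0.
Proof.
move=> dM l0 r.
set K := #|{ffun 'I_d -> 'I_`|\det M|}|%:R : R[i].
have K0 : K != 0.
  rewrite pnatr_eq0 card_ffun card_ord expn_eq0 negb_and.
  by rewrite -lt0n absz_gt0 dM.
apply: (mulIf K0); rewrite mul0r big_distrl /= big_mkcond /=.
transitivity (\sum_(f : {ffun 'I_d -> 'I_`|\det M|})
    wave (- r) (dual_pt R M (box_pt f)) * epoly l (dual_pt R M (box_pt f))).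
  under [RHS]eq_bigr => f _ do rewrite /epoly big_distrr /=.
  rewrite exchange_big /=; apply: eq_bigr => p _.
  under eq_bigr => f _ do rewrite mulrCA -waveD addrC.
  by rewrite -big_distrr /= wave_box_sum // -/K; case: ifP; rewrite ?mulr0.
by apply: big1 => f _; rewrite l0 mulr0.
Qed.

(** The sum of the c_n e(rho(n)) is zero, its coefficients being the coset sums;
    it may thus be subtracted from the polynomial, after which each term
    c_n (e(n) - e(rho(n))) is in the ideal. *)
Lemma epoly_in_ideal (R : realType) d (M : 'M[int]_d)
    (l : seq (R[i] * 'cV[int]_d)) :
  \det M != 0 -> (forall s, epoly l (dual_pt R M s) = 0) ->
  in_ideal M (epoly l).
Proof.
move=> dM l0; pose rho := lattice_repr M.
have rho0 x : \sum_(p <- l) p.1 * wave (rho p.2) x = 0.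
  pose S := undup [seq rho p.2 | p <- l].
  transitivity (\sum_(r <- S) wave r x * \sum_(p <- l | rho p.2 == r) p.1).
    under [RHS]eq_bigr => r _ do rewrite big_distrr big_mkcond /=.
    rewrite exchange_big /= !big_seq; apply: eq_bigr => p pl.
    rewrite (bigD1_seq (rho p.2)) ?undup_uniq ?mem_undup //=; last first.
      exact: (map_f (fun p => rho p.2)).
    rewrite eqxx big1 ?addr0 1?mulrC // => r; rewrite eq_sym.
    by move=> /negbTE ->.
  rewrite big_seq big1 // => r; rewrite mem_undup => /mapP[q _ ->].
  under eq_bigl => p do rewrite lattice_reprE.
  by rewrite coset_sum_eq0 // mulr0.
pose F (p : R[i] * 'cV[int]_d) x := p.1 * wave p.2 x - p.1 * wave (rho p.2) x.
apply: (@eq_in_ideal _ _ _ (fun x => \sum_(p <- l) F p x)).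
  by move=> x; rewrite sumrB rho0 subr0.
apply: in_ideal_sum => p.
have /asboolP[m mE] := lattice_reprP M p.2.
have {}mE : p.2 = rho p.2 + M *m m by rewrite -mE addrC subrK.
apply: eq_in_ideal (in_ideal_monoM (- p.1) (rho p.2) (in_ideal_lattice R M m)).
by move=> x; rewrite /F [in wave p.2 x]mE waveD; ring.
Qed.


(** * Values at the origin *)

Lemma is_derive_linear (R : realType) (a : R) :
  is_derive (0 : R) 1 (fun h : R => 2 * pi * (a * h)) (2 * pi * a).
Proof.
have -> : (fun h : R => 2 * pi * (a * h)) = (2 * pi * a) \*: id.
  by apply/funext => h; rewrite mulrA.
apply: is_derive_eq (is_deriveZ _ (is_derive_id _ _)) _.
by rewrite /GRing.scale /= mulr1.
Qed.

Lemma is_derive_cos_linear (R : realType) (a : R) :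
  is_derive (0 : R) 1 (fun h => cos (2 * pi * (a * h))) 0.
Proof.
apply: is_derive_eq (is_derive1_comp (is_derive_cos _) (is_derive_linear a)) _.
by rewrite !mulr0 sin0 oppr0 mul0r.
Qed.

Lemma is_derive_sin_linear (R : realType) (a : R) :
  is_derive (0 : R) 1 (fun h => sin (2 * pi * (a * h))) (2 * pi * a).
Proof.
apply: is_derive_eq (is_derive1_comp (is_derive_sin _) (is_derive_linear a)) _.
by rewrite !mulr0 cos0 mul1r.
Qed.

(** Up to the factor 2 pi i this sum is the derivative at h = 0 of the
    vanishing exponential sum; real and imaginary parts are differentiated
    separately. *)
Lemma first_moment_eq0 (R : realType) (l : seq (R[i] * R)) :
  (forall h, \sum_(p <- l) p.1 * expi2pi (p.2 * h) = 0) ->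
  \sum_(p <- l) p.1 * p.2%:C = 0.
Proof.
pose f (l : seq (R[i] * R)) h := \sum_(p <- l) p.1 * expi2pi (p.2 * h).
move=> l0.
have [fR fI] : is_derive (0 : R) 1 (fun h => complex.Re (f l h))
      (- (2 * pi * complex.Im (\sum_(p <- l) p.1 * p.2%:C))) /\
   is_derive (0 : R) 1 (fun h => complex.Im (f l h))
      (2 * pi * complex.Re (\sum_(p <- l) p.1 * p.2%:C)).
  elim: l {l0} => [|[[u v] a] l [IHr IHi]].
    have f0 h : f [::] h = 0 by rewrite /f big_nil.
    rewrite !big_nil /= !mulr0 oppr0.
    by split; under eq_fun do rewrite f0 /=; exact: is_derive_cst.
  have C := is_derive_cos_linear a; have S := is_derive_sin_linear a.
  have fE h : f ((u +i* v, a) :: l) h = (u +i* v) * expi2pi (a * h) + f l h.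
    by rewrite /f big_cons.
  rewrite !big_cons; split.
    have -> : (fun h => complex.Re (f ((u +i* v, a) :: l) h)) =
        ((u \*: fun h => cos (2 * pi * (a * h))) -
         (v \*: fun h => sin (2 * pi * (a * h)))) +
        (fun h => complex.Re (f l h)).
      by apply/funext => h; rewrite fE raddfD.
    apply: is_derive_eq
      (is_deriveD (is_deriveB (is_deriveZ u C) (is_deriveZ v S)) IHr) _.
    by rewrite raddfD /= /GRing.scale /=; ring.
  have -> : (fun h => complex.Im (f ((u +i* v, a) :: l) h)) =
      ((u \*: fun h => sin (2 * pi * (a * h))) +
       (v \*: fun h => cos (2 * pi * (a * h)))) +
      (fun h => complex.Im (f l h)).
    by apply/funext => h; rewrite fE raddfD.
  apply: is_derive_eq
    (is_deriveD (is_deriveD (is_deriveZ u S) (is_deriveZ v C)) IHi) _.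
  by rewrite raddfD /= /GRing.scale /=; ring.
have f0 : f l = fun=> 0 by apply/funext => h; exact: l0.
have pi2 : 2 * pi != 0 :> R by rewrite mulf_neq0 ?pnatr_eq0 // gt_eqF ?pi_gt0.
have Im0 : complex.Im (\sum_(p <- l) p.1 * p.2%:C) = 0.
  apply: (mulfI pi2); rewrite mulr0; apply/eqP; rewrite -oppr_eq0; apply/eqP.
  by rewrite -(@derive_val _ _ _ _ _ _ _ fR) f0 /= derive_cst.
have Re0 : complex.Re (\sum_(p <- l) p.1 * p.2%:C) = 0.
  apply: (mulfI pi2); rewrite mulr0.
  by rewrite -(@derive_val _ _ _ _ _ _ _ fI) f0 /= derive_cst.
by apply/eqP; rewrite eq_complex /= Re0 Im0 !eqxx.
Qed.

Lemma epoly0 (R : realType) d (l : seq (R[i] * 'cV[int]_d)) :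
  epoly l 0 = \sum_(p <- l) p.1.
Proof.
by apply: eq_bigr => p _; rewrite wave_at0 mulr1.
Qed.

(** Both sides vanish at h = 0, with derivatives - 2 pi i a t(0) and
    - 2 pi i b u(0) there. *)
Lemma proportional_at0 (R : realType) d (t u : 'cV[R]_d -> R[i]) v a b :
  trig_poly t -> trig_poly u ->
  (forall h, (1 - expi2pi (a * h)) * t (h *: v) =
             (1 - expi2pi (b * h)) * u (h *: v)) ->
  a%:C * t 0 = b%:C * u 0.
Proof.
move=> /trig_polyP[l tE] /trig_polyP[m uE] tu.
rewrite tE uE !epoly0.
pose g (n : 'cV[int]_d) := inner (map_mx intr n) v.
(* The terms of (1 - e^(2 pi i c h)) p(h v), as an exponential sum in h. *)
pose terms c (l : seq (R[i] * 'cV[int]_d)) := [seq (p.1, g p.2) | p <- l] ++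
  [seq (- p.1, c + g p.2) | p <- l].
have termsE c s h : \sum_(p <- terms c s) p.1 * expi2pi (p.2 * h) =
    (1 - expi2pi (c * h)) * epoly s (h *: v).
  rewrite /terms big_cat !big_map /= -big_split big_distrr.
  apply: eq_bigr => p _ /=.
  rewrite /wave innerZr -/(g p.2) [in RHS]mulrC [h * _]mulrC mulrDl expi2piD.
  ring.
have termsM c s :
    \sum_(p <- terms c s) p.1 * p.2%:C = - (c%:C * \sum_(p <- s) p.1).
  rewrite /terms big_cat !big_map /= -big_split big_distrr -sumrN.
  apply: eq_bigr => p _ /=; rewrite rmorphD /=; ring.
have := @first_moment_eq0 R
  (terms a l ++ [seq (- p.1, p.2) | p <- terms b m]).
have sumN (F : R -> R[i]) : \sum_(p <- [seq (- p.1, p.2) | p <- terms b m])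
    p.1 * F p.2 = - \sum_(p <- terms b m) p.1 * F p.2.
  by rewrite big_map -sumrN; apply: eq_bigr => p _; rewrite mulNr.
rewrite big_cat /= (sumN (fun y => y%:C)) !termsM opprK => moment0.
apply/esym/eqP; rewrite -subr_eq0 addrC; apply/eqP/moment0 => h.
rewrite big_cat /= (sumN (fun y => expi2pi (y * h))) !termsE.
by rewrite -tE -uE tu subrr.
Qed.

(** * The theorem *)

Theorem proposition7 (R : realType) (d : nat) (M : 'M[int]_d)
    (D : set 'cV[int]_d) (t : 'cV[R]_d -> R[i])
    (hM : dilation_matrix R M) (hD : digit_set M^T D) (ht : trig_poly t) :
  (Z0 M D t ->
     exists tt : 'I_d -> 'I_d -> 'cV[R]_d -> R[i],
       (forall j k, trig_poly (tt j k)) /\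
       forall (k : 'I_d) (x : 'cV[R]_d),
         (1 - expi2pi (inner x (unit_vec R k))) * t x =
         \sum_(j < d) tt j k x *
           (1 - expi2pi (inner (map_mx intr M^T *m x) (unit_vec R j)))) /\
  (forall tt : 'I_d -> 'I_d -> 'cV[R]_d -> R[i],
     (forall j k, trig_poly (tt j k)) ->
     (forall (k : 'I_d) (x : 'cV[R]_d),
         (1 - expi2pi (inner x (unit_vec R k))) * t x =
         \sum_(j < d) tt j k x *
           (1 - expi2pi (inner (map_mx intr M^T *m x) (unit_vec R j)))) ->
     Z0 M D t /\
     forall j k, tt j k 0 = (invmx (map_mx intr M) j k)%:C * t 0).
Proof.
have [dM _] := hM; have [D0 Drepr] := hD.
have uM : map_mx intr M^T \in @unitmx R d by rewrite unitmx_intr // det_tr.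
split=> [[_ tD]|tt ttP ttE].
  have vanish k s :
      (1 - wave (delta_mx k 0) (dual_pt R M s)) * t (dual_pt R M s) = 0.
    have [r [[Dr [m sE]] _]] := Drepr s.
    have -> : dual_pt R M s = dual_pt R M r + map_mx intr m.
      by rewrite /dual_pt sE map_mxD map_mxM mulmxDr mulKmx.
    rewrite waveDr wave_int mulr1 (trig_poly_periodic _ _ ht).
    have [->|r0] := eqVneq r 0; last by rewrite tD ?mulr0.
    by rewrite /dual_pt map_mx0 mulmx0 wave_at0 subrr mul0r.
  have ideal k : in_ideal M (fun x => (1 - wave (delta_mx k 0) x) * t x).
    have /trig_polyP[l lE] :
        trig_poly (fun x => (1 - wave (delta_mx k 0) x) * t x).
      apply: eq_trig_poly
        (trig_polyD ht (trig_poly_monoM (-1) (delta_mx k 0) ht)).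
      by move=> x; ring.
    have lM : in_ideal M (epoly l).
      by apply: epoly_in_ideal => // s; rewrite -lE vanish.
    by apply: eq_in_ideal lM => x; rewrite lE.
  have [q qP] := choice ideal.
  exists (fun j k => q k j); split=> [j k|k x]; first by have [] := qP k.
  have [_ qE] := qP k; rewrite -wave_unit_vec qE.
  by apply: eq_bigr => j _; rewrite wave_col.
split.
  split=> // s Ds s0; rewrite -/(dual_pt R M s).
  apply: contra_neq_eq s0 => ts.
  have int k : exists m : int, dual_pt R M s k 0 = m%:~R.
    apply: expi2pi_eq1; apply/eqP; rewrite eq_sym -subr_eq0.
    have /eqP := ttE k (dual_pt R M s).
    rewrite big1 => [|j _].
      by rewrite mulf_eq0 (negbTE ts) orbF inner_unit_vec.
    by rewrite mulKVmx // inner_unit_vec mxE expi2pi_int subrr mulr0.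
  have [m mE] := choice int.
  have sE : s = M^T *m \col_k m k.
    apply: (@map_intr_cV_inj R); rewrite map_mxM.
    rewrite -[LHS](mulKVmx uM); congr (_ *m _).
    by apply/matrixP => j k; rewrite ord1 -/(dual_pt R M s) mE !mxE.
  (* Both s and 0 are digits of the coset of s. *)
  have [r [_ rU]] := Drepr s.
  rewrite -(rU s); first apply: rU.
    by split=> //; exists (\col_k m k); rewrite add0r.
  by split=> //; exists 0; rewrite mulmx0 addr0.
move=> j k; set a := invmx _ j k.
have aE : dual_pt R M (delta_mx j 0) k 0 = a.
  by rewrite /dual_pt map_delta_mx -colE mxE -map_trmx -trmx_inv mxE.
have := @proportional_at0 R d t (tt j k) (dual_pt R M (delta_mx j 0)) a 1
  ht (ttP j k).
rewrite rmorph1 mul1r => -> // h.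
(* On this line M^T x = h e_j, so the factors 1 - e(M e_i), i <> j, vanish. *)
have := ttE k (h *: dual_pt R M (delta_mx j 0)).
have Mx :
    map_mx intr M^T *m (h *: dual_pt R M (delta_mx j 0)) = h *: unit_vec R j.
  by rewrite -scalemxAr mulKVmx // map_delta_mx.
rewrite Mx inner_unit_vec (bigD1 j) //= big1 => [|i ij]; last first.
  by rewrite inner_unit_vec !mxE (negbTE ij) mulr0 expi2pi0 subrr mulr0.
have uE : (h *: unit_vec R j) j 0 = h by rewrite !mxE !eqxx mulr1.
rewrite addr0 !inner_unit_vec [_ k 0]mxE aE uE mul1r [h * a]mulrC => ->.
by rewrite mulrC.
Qed.
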